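(* $$\int_0^1 \psi^2(1+x)\,dx = 2\sum_{n=1}^{\infty} \frac{\log(n+1)}{n(n+1)} + 1 - 2\varsigma(2) + 2\gamma_1 .$$
   Context: $\psi(x)=\Gamma'(x)/\Gamma(x)$ is the digamma function and $\psi^2(1+x)=(\psi(1+x))^2$. $\varsigma(s)$ is the Riemann zeta function. $\gamma_1$ is the first Stieltjes constant, $\gamma_1=\lim_{N\to\infty}\left[\sum_{k=1}^{N}\frac{\log k}{k}-\frac12\log^2 N\right]$. *)

(* Defs.v *)
From Stdlib Require Import Reals.
From Coquelicot Require Import Coquelicot.
Open Scope R_scope.

(* Euler's integral of the second kind, improper at both ends. It converges,
   and so represents the Gamma function, for x > 0 only. *)
Definition Gamma (x : R) : R :=
  RInt_gen (fun t : R => Rpower t (x - 1) * exp (- t))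
    (at_right 0) (Rbar_locally p_infty).

Definition digamma (x : R) : R := Derive Gamma x / Gamma x.

(* The Dirichlet series: it represents the Riemann zeta function for real
   s > 1 only. *)
Definition zeta (s : R) : R := Series (fun n : nat => / Rpower (INR (S n)) s).

Definition stieltjes1 : R :=
  real (Lim_seq (fun N : nat =>
    sum_n_m (fun k : nat => ln (INR k) / INR k) 1 N - / 2 * (ln (INR N)) ^ 2)).

(* Main.v *)
Require Import Defs.
From Stdlib Require Import Reals Lra Lia.
From Coquelicot Require Import Coquelicot.
Open Scope R_scope.

(** On the open unit interval the digamma function satisfies
    [digamma (1 + x) = lim D_n x] with
    [D_n x = ln (n + 1) - sum_(k = 1..n) 1 / (k + x)], uniformly in [x], so the
    integral of its square is the limit of the integrals of [D_n ^ 2], which are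
    elementary.

    The limit formula comes from Euler's integral.  The kernel satisfies
    [t^a <= s^a (1 - a + a t / s)] (weighted AM-GM); integrating this against
    [t^(s - 1) e^(-t)] and using [Gamma (s + 1) = s Gamma s] yields Wendel's
    inequality [Gamma (s + a) <= s^a Gamma s] ([Gamma_add_le]).  Applied at
    [s = n + 1] and at [s = n + 1 + x], it places [ln (Gamma (1 + x))] within
    [1 / (n + 1)] of the Euler product approximant whose derivative is [D_n]
    ([lnGamma_approx_bound]).  As the [D_n] are uniformly Cauchy
    ([digamma_approx_cauchy]), differentiation passes to the limit
    ([digamma_eq_lim]).

    Expanding [D_n ^ 2], partial fractions and a summation by parts turn its
    integral into ([is_RInt_digamma_approx_sq])

      [1 - 1 / (n + 1) - 2 sum_(m <= n) (- ln (1 - m / (n + 1))) / m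
         + 2 sum_(k <= n) ln (k + 1) / (k (k + 1))
         + 2 (sum_(k <= n + 1) ln k / k - ln (n + 1) ^ 2 / 2)].

    The first sum is a Riemann sum of [- ln (1 - u) / u] over the unit interval;
    it tends to [zeta 2] because expanding the logarithm replaces it by sums of
    powers that are explicitly comparable with [1 / j ^ 2]
    ([dilog_riemann_sum_lim]).  The second is a partial sum of the series in the
    theorem, and the last bracket is the sequence that defines the Stieltjes
    constant; its convergence follows from that of the other terms. *)

(** * Elementary facts *)

Lemma ball_Rabs (x y e : R) : ball x e y <-> Rabs (y - x) < e.
Proof. reflexivity. Qed.

Lemma at_right_0_interval (d : R) : 0 < d -> at_right 0 (fun a => 0 < a < d).
Proof.
  intros Hd. exists (mkposreal d Hd). intros y Hy H0.
  apply -> ball_Rabs in Hy. rewrite Rminus_0_r in Hy.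
  split; [exact H0 |]. exact (Rle_lt_trans _ _ _ (Rle_abs y) Hy).
Qed.

Lemma ln_le_pred (u : R) : 0 < u -> ln u <= u - 1.
Proof.
  intros Hu. pose proof (exp_ineq1_le (ln u)) as H. rewrite exp_ln in H; lra.
Qed.

Lemma ln_succ_sub_bounds (x : R) :
  0 < x -> / (x + 1) <= ln (x + 1) - ln x <= / x.
Proof.
  intros Hx.
  assert (H1 : ln (x / (x + 1)) <= x / (x + 1) - 1)
    by (apply ln_le_pred, Rdiv_lt_0_compat; lra).
  assert (H2 : ln ((x + 1) / x) <= (x + 1) / x - 1)
    by (apply ln_le_pred, Rdiv_lt_0_compat; lra).
  rewrite ln_div in H1 by lra. rewrite ln_div in H2 by lra.
  replace (x / (x + 1) - 1) with (- / (x + 1)) in H1 by (field; lra).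
  replace ((x + 1) / x - 1) with (/ x) in H2 by (field; lra).
  lra.
Qed.

(** Weighted AM-GM for [u] and 1: the tangent to [exp] at [a ln u] lies below [exp]
    at both [ln u] and 0, and [a ln u] is their weighted mean. *)
Lemma Rpower_le_affine (a u : R) :
  0 <= a <= 1 -> 0 < u -> Rpower u a <= 1 - a + a * u.
Proof.
  intros Ha Hu. unfold Rpower.
  set (y := ln u). assert (Hy : u = exp y) by (unfold y; rewrite exp_ln; lra).
  set (z := a * y).
  assert (H1 : exp z * (1 + (y - z)) <= exp y).
  { replace (exp y) with (exp z * exp (y - z)) by (rewrite <- exp_plus; f_equal; ring).
    apply Rmult_le_compat_l; [apply Rlt_le, exp_pos | apply exp_ineq1_le]. }
  assert (H2 : exp z * (1 - z) <= 1).
  { replace 1 with (exp z * exp (- z)) at 2 by (rewrite <- exp_plus, Rplus_opp_r; apply exp_0).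
    apply Rmult_le_compat_l; [apply Rlt_le, exp_pos | apply exp_ineq1_le]. }
  rewrite Hy.
  assert (H3 : a * (exp z * (1 + (y - z))) <= a * exp y)
    by (apply Rmult_le_compat_l; lra).
  assert (H4 : (1 - a) * (exp z * (1 - z)) <= (1 - a) * 1)
    by (apply Rmult_le_compat_l; lra).
  replace (exp z) with (a * (exp z * (1 + (y - z))) + (1 - a) * (exp z * (1 - z))).
  - lra.
  - unfold z; ring.
Qed.

(** * Euler's integral *)

Definition gamma_kernel (s t : R) : R := Rpower t (s - 1) * exp (- t).

Lemma gamma_kernel_pos (s t : R) : 0 < gamma_kernel s t.
Proof. apply Rmult_lt_0_compat; apply exp_pos. Qed.

Lemma is_derive_gamma_kernel (s t : R) :
  0 < t ->
  is_derive (gamma_kernel (s + 1)) t (s * gamma_kernel s t - gamma_kernel (s + 1) t).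
Proof.
  intros Ht. unfold gamma_kernel, Rpower.
  auto_derive; [lra |].
  replace ((s - 1) * ln t) with ((s + 1 - 1) * ln t + - ln t) by ring.
  rewrite (exp_plus _ (- ln t)), (exp_Ropp (ln t)), exp_ln by lra. field. lra.
Qed.

Lemma continuous_gamma_kernel (s t : R) : 0 < t -> continuous (gamma_kernel s) t.
Proof.
  intros Ht. replace s with ((s - 1) + 1) by ring.
  apply (ex_derive_continuous (gamma_kernel (s - 1 + 1))).
  eexists. now apply is_derive_gamma_kernel.
Qed.

(** From [ln u <= u - 1] at [u = t / (2 p)]; half of the exponential decay is kept
    for integrability. *)
Lemma gamma_kernel_le_exp (p : R) :
  0 < p ->
  exists C, 0 < C /\ forall t, 0 < t -> gamma_kernel (p + 1) t <= C * exp (- t / 2).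
Proof.
  intros Hp. exists (exp (p * ln (2 * p))). split; [apply exp_pos |].
  intros t Ht. unfold gamma_kernel, Rpower.
  rewrite <- !exp_plus.
  assert (H : ln (t / (2 * p)) <= t / (2 * p) - 1)
    by (apply ln_le_pred, Rdiv_lt_0_compat; lra).
  rewrite ln_div in H by lra.
  assert (H' : p * ln t <= p * ln (2 * p) + t / 2).
  { replace (t / 2) with (p * (t / (2 * p))) by (field; lra).
    rewrite <- Rmult_plus_distr_l. apply Rmult_le_compat_l; lra. }
  replace ((p + 1 - 1) * ln t + - t) with (p * ln t - t) by ring.
  destruct (Rle_lt_or_eq_dec (p * ln t - t) (p * ln (2 * p) + - t / 2)) as [G|G].
  - lra.
  - left; now apply exp_increasing.
  - right; now rewrite G.
Qed.

(** The directed family of proper integrals over compact subintervals of the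
    half-line is monotone, so its supremum is its limit. *)
Lemma ex_RInt_gen_nonneg_bounded (f : R -> R) (M : R) :
  (forall t, 0 < t -> continuous f t) ->
  (forall t, 0 < t -> 0 <= f t) ->
  (forall a b, 0 < a -> a <= b -> RInt f a b <= M) ->
  ex_RInt_gen f (at_right 0) (Rbar_locally p_infty).
Proof.
  intros Hc Hf HM.
  assert (Hex : forall a b, 0 < a -> 0 < b -> ex_RInt f a b).
  { intros a b Ha Hb. apply (ex_RInt_continuous (V := R_CompleteNormedModule)).
    intros z [Hz _]. apply Hc. apply Rlt_le_trans with (2 := Hz). now apply Rmin_glb_lt. }
  set (E := fun v => exists a b, 0 < a /\ a <= b /\ v = RInt f a b).
  destruct (completeness E) as [L [HU HL]].
  - exists M. intros v (a & b & Ha & Hab & ->). now apply HM.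
  - exists (RInt f 1 1), 1, 1. repeat split; lra.
  - exists L. intros P [eps HP].
    assert (Hv : exists a b, 0 < a /\ a <= b /\ L - eps < RInt f a b).
    { apply Classical_Prop.NNPP. intros Hn.
      assert (L <= L - eps); [| destruct eps; simpl in *; lra].
      apply HL. intros v (a & b & Ha & Hab & ->).
      apply Rnot_lt_le. intros Hlt. apply Hn. now exists a, b. }
    destruct Hv as (a0 & b0 & Ha0 & Hab0 & Hv).
    (* Enlarging the interval brings the integral closer to its supremum. *)
    apply (Filter_prod _ _ _ (fun a => 0 < a < a0) (fun b => b0 < b)).
    + now apply at_right_0_interval.
    + exists b0. auto.
    + intros a b Ha Hb. simpl. exists (RInt f a b).
      split; [apply (RInt_correct (V := R_CompleteNormedModule)); apply Hex; lra |].
      apply HP.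
      assert (H1 : RInt f a b <= L) by (apply HU; exists a, b; repeat split; lra).
      assert (H2 : RInt f a0 b0 <= RInt f a b).
      { rewrite <- (RInt_Chasles f a a0 b) by (apply Hex; lra).
        rewrite <- (RInt_Chasles f a0 b0 b) by (apply Hex; lra).
        unfold plus; simpl.
        assert (0 <= RInt f a a0)
          by (apply RInt_ge_0; [lra | apply Hex; lra | intros; apply Hf; lra]).
        assert (0 <= RInt f b0 b)
          by (apply RInt_ge_0; [lra | apply Hex; lra | intros; apply Hf; lra]).
        lra. }
      apply <- ball_Rabs. apply Rabs_def1; lra.
Qed.

Lemma gamma_kernel_lim_0 (s : R) :
  0 < s -> filterlim (gamma_kernel (s + 1)) (at_right 0) (locally 0).
Proof.
  intros Hs. apply filterlim_locally. intros eps.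
  assert (Hd : 0 < Rpower eps (/ s)) by apply exp_pos.
  exists (mkposreal _ Hd). intros t Ht Ht0.
  apply -> ball_Rabs in Ht. apply <- ball_Rabs. simpl in Ht.
  rewrite Rminus_0_r in Ht |- *.
  rewrite Rabs_pos_eq in Ht by lra.
  rewrite Rabs_pos_eq by apply Rlt_le, gamma_kernel_pos.
  unfold gamma_kernel. replace (s + 1 - 1) with s by ring.
  assert (H1 : Rpower t s < Rpower (Rpower eps (/ s)) s) by now apply Rlt_Rpower_l.
  rewrite Rpower_mult, Rinv_l, Rpower_1 in H1 by (try apply cond_pos; lra).
  assert (H2 : exp (- t) <= 1).
  { rewrite <- exp_0. left; apply exp_increasing; lra. }
  apply Rle_lt_trans with (2 := H1).
  rewrite <- (Rmult_1_r (Rpower t s)) at 2.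
  apply Rmult_le_compat_l; [apply Rlt_le, exp_pos | exact H2].
Qed.

Lemma gamma_kernel_lim_p_infty (s : R) :
  0 < s -> filterlim (gamma_kernel (s + 1)) (Rbar_locally p_infty) (locally 0).
Proof.
  intros Hs. destruct (gamma_kernel_le_exp s Hs) as (C & HC & Hle).
  apply filterlim_locally. intros eps.
  exists (Rmax 0 (- (2 * ln (eps / C)))). intros t Ht.
  assert (Ht0 : 0 < t) by (eapply Rle_lt_trans; [apply Rmax_l | exact Ht]).
  assert (Ht1 : - (2 * ln (eps / C)) < t) by (eapply Rle_lt_trans; [apply Rmax_r | exact Ht]).
  apply <- ball_Rabs. rewrite Rminus_0_r.
  rewrite Rabs_pos_eq by apply Rlt_le, gamma_kernel_pos.
  apply Rle_lt_trans with (1 := Hle t Ht0).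
  assert (He : 0 < eps / C) by (apply Rdiv_lt_0_compat; [apply cond_pos | exact HC]).
  assert (H : exp (- t / 2) < eps / C).
  { rewrite <- (exp_ln (eps / C)) by exact He. apply exp_increasing. lra. }
  apply (Rmult_lt_compat_l C) in H; [| exact HC].
  replace (C * (eps / C)) with (pos eps) in H by (field; lra). exact H.
Qed.

Lemma ex_RInt_gen_gamma_kernel_gt1 (p : R) :
  0 < p -> ex_RInt_gen (gamma_kernel (p + 1)) (at_right 0) (Rbar_locally p_infty).
Proof.
  intros Hp. destruct (gamma_kernel_le_exp p Hp) as (C & HC & Hle).
  apply ex_RInt_gen_nonneg_bounded with (M := 2 * C).
  - intros t Ht; now apply continuous_gamma_kernel.
  - intros t _; apply Rlt_le, gamma_kernel_pos.
  - intros a b Ha Hab.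
    assert (HI : is_RInt (fun t => C * exp (- t / 2)) a b
                   (minus (- 2 * C * exp (- b / 2)) (- 2 * C * exp (- a / 2)))).
    { apply (is_RInt_derive (fun t => - 2 * C * exp (- t / 2))).
      - intros x _. auto_derive; [easy |]. unfold Rdiv; field.
      - intros x _. apply (ex_derive_continuous (fun t => C * exp (- t / 2))).
        auto_derive; easy. }
    apply Rle_trans with (minus (- 2 * C * exp (- b / 2)) (- 2 * C * exp (- a / 2))).
    + apply is_RInt_le with (f := gamma_kernel (p + 1)) (g := fun t => C * exp (- t / 2))
        (a := a) (b := b); [exact Hab | | exact HI | intros x Hx; apply Hle; lra].
      apply (RInt_correct (V := R_CompleteNormedModule)), (ex_RInt_continuous (V := R_CompleteNormedModule)).
      intros z Hz. rewrite Rmin_left, Rmax_right in Hz by lra.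
      apply continuous_gamma_kernel; lra.
    + unfold minus, plus, opp; simpl.
      assert (0 < exp (- b / 2)) by apply exp_pos.
      assert (exp (- a / 2) < 1) by (rewrite <- exp_0; apply exp_increasing; lra).
      nra.
Qed.

Lemma filter_prod_pos_le :
  filter_prod (at_right 0) (Rbar_locally p_infty)
    (fun ab : R * R => 0 < fst ab /\ fst ab <= snd ab).
Proof.
  apply (Filter_prod _ _ _ (fun a => 0 < a < 1) (fun b => 1 < b)).
  - apply at_right_0_interval; lra.
  - now exists 1.
  - simpl; intros; lra.
Qed.

Lemma is_RInt_gen_derive_half_line (F f : R -> R) (la lb : R) :
  (forall t, 0 < t -> is_derive F t (f t)) ->
  (forall t, 0 < t -> continuous f t) ->
  filterlim F (at_right 0) (locally la) ->
  filterlim F (Rbar_locally p_infty) (locally lb) ->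
  is_RInt_gen f (at_right 0) (Rbar_locally p_infty) (lb - la).
Proof.
  intros HF Hf Ha Hb.
  assert (HD : forall t, 0 < t -> Derive F t = f t)
    by (intros t Ht; now apply is_derive_unique, HF).
  apply (is_RInt_gen_ext (Derive F)).
  - generalize filter_prod_pos_le. apply filter_imp. intros [a b] [H0 H1] x Hx; simpl in *.
    rewrite Rmin_left in Hx by lra. apply HD. lra.
  - apply is_RInt_gen_Derive; [ | | exact Ha | exact Hb];
    generalize filter_prod_pos_le; apply filter_imp; intros [a b] [H0 H1] x Hx; simpl in *;
      rewrite Rmin_left in Hx by lra.
    + exists (f x). apply HF; lra.
    + apply (continuous_ext_loc _ f).
      * assert (Hx0 : 0 < x) by lra. exists (mkposreal x Hx0). intros y Hy.
        apply -> ball_Rabs in Hy. apply Rabs_def2 in Hy. simpl in Hy. symmetry; apply HD; lra.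
      * apply Hf; lra.
Qed.

(** Integration by parts, arranged to give the convergence of Euler's integral at [s]
    from its convergence at [s + 1] together with the functional equation. *)
Lemma is_RInt_gen_gamma_kernel_pred (s l : R) :
  0 < s ->
  is_RInt_gen (gamma_kernel (s + 1)) (at_right 0) (Rbar_locally p_infty) l ->
  is_RInt_gen (gamma_kernel s) (at_right 0) (Rbar_locally p_infty) (/ s * l).
Proof.
  intros Hs Hl.
  assert (HB : is_RInt_gen (fun t => s * gamma_kernel s t - gamma_kernel (s + 1) t)
                 (at_right 0) (Rbar_locally p_infty) (0 - 0)).
  { apply (is_RInt_gen_derive_half_line (gamma_kernel (s + 1))).
    - intros t Ht; now apply is_derive_gamma_kernel.
    - intros t Ht. apply (continuous_minus (fun t => s * gamma_kernel s t)).
      + apply (continuous_mult (fun _ => s) (gamma_kernel s)); [apply continuous_const |]. now apply continuous_gamma_kernel.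
      + now apply continuous_gamma_kernel.
    - now apply gamma_kernel_lim_0.
    - now apply gamma_kernel_lim_p_infty. }
  pose proof (is_RInt_gen_scal _ (/ s) _ (is_RInt_gen_plus _ _ _ _ HB Hl)) as H.
  replace (/ s * l) with (scal (/ s) (plus (0 - 0) l))
    by (unfold scal, plus; simpl; unfold mult; simpl; ring).
  revert H. apply is_RInt_gen_ext.
  generalize filter_prod_pos_le. apply filter_imp. intros _ _ x _.
  unfold scal, plus; simpl; unfold mult; simpl. field. lra.
Qed.

Lemma is_RInt_gen_Gamma (s : R) :
  0 < s -> is_RInt_gen (gamma_kernel s) (at_right 0) (Rbar_locally p_infty) (Gamma s).
Proof.
  intros Hs. apply (RInt_gen_correct (V := R_CompleteNormedModule)).
  destruct (ex_RInt_gen_gamma_kernel_gt1 s Hs) as [l Hl].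
  exists (/ s * l). now apply is_RInt_gen_gamma_kernel_pred.
Qed.

Lemma Gamma_unique (s l : R) :
  is_RInt_gen (gamma_kernel s) (at_right 0) (Rbar_locally p_infty) l -> Gamma s = l.
Proof. apply (is_RInt_gen_unique (V := R_CompleteNormedModule)). Qed.

Lemma Gamma_succ (s : R) : 0 < s -> Gamma (s + 1) = s * Gamma s.
Proof.
  intros Hs.
  rewrite (Gamma_unique s (/ s * Gamma (s + 1))).
  - field. lra.
  - apply is_RInt_gen_gamma_kernel_pred; [exact Hs |]. apply is_RInt_gen_Gamma; lra.
Qed.

Lemma Gamma_1 : Gamma 1 = 1.
Proof.
  apply Gamma_unique. replace 1 with (0 - (-1)) at 2 by ring.
  apply (is_RInt_gen_derive_half_line (fun t => - exp (- t))).
  - intros t Ht. unfold gamma_kernel. replace (1 - 1) with 0 by ring.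
    rewrite Rpower_O by exact Ht. auto_derive; [easy | ring].
  - intros t Ht; now apply continuous_gamma_kernel.
  - apply (filterlim_filter_le_1 (F := locally 0)); [apply filter_le_within; apply locally_filter |].
    replace (-1) with (- exp (- 0)) by (rewrite Ropp_0, exp_0; ring).
    apply (ex_derive_continuous (fun t => - exp (- t))). auto_derive; easy.
  - replace 0 with (- 0) by ring.
    apply (filterlim_comp _ _ _ (fun t => exp (- t)) Ropp _ (locally 0)).
    + apply (is_lim_comp exp Ropp p_infty 0 m_infty).
      * apply is_lim_exp_m.
      * apply (is_lim_opp (fun t => t) p_infty p_infty), is_lim_id.
      * now exists 0.
    + apply (filterlim_opp (V := R_NormedModule) 0).
Qed.

(** Weighted AM-GM gives [t^a <= s^a (1 - a + a t / s)], with equality at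
    [t = s], the centre of mass of the kernel; integrating, the right-hand side
    collapses by the functional equation.  This replaces Hoelder's inequality
    (log-convexity) in the Bohr-Mollerup argument. *)
Lemma Gamma_add_le (s a : R) :
  0 < s -> 0 <= a <= 1 -> Gamma (s + a) <= Rpower s a * Gamma s.
Proof.
  intros Hs Ha.
  assert (HR : is_RInt_gen
     (fun t => Rpower s a * ((1 - a) * gamma_kernel s t + (a / s) * gamma_kernel (s + 1) t))
     (at_right 0) (Rbar_locally p_infty) (Rpower s a * Gamma s)).
  { replace (Rpower s a * Gamma s) with
      (scal (Rpower s a) (plus (scal (1 - a) (Gamma s)) (scal (a / s) (Gamma (s + 1))))).
    - apply (is_RInt_gen_scal (fun t => (1 - a) * gamma_kernel s t + a / s * gamma_kernel (s + 1) t)).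
      apply (is_RInt_gen_plus (fun t => (1 - a) * gamma_kernel s t) (fun t => a / s * gamma_kernel (s + 1) t)).
      + apply (is_RInt_gen_scal (gamma_kernel s)). now apply is_RInt_gen_Gamma.
      + apply (is_RInt_gen_scal (gamma_kernel (s + 1))). apply is_RInt_gen_Gamma; lra.
    - rewrite Gamma_succ by exact Hs.
      unfold scal, plus; simpl; unfold mult; simpl. field. lra. }
  apply Rle_trans with (norm (Gamma (s + a))); [apply Rle_abs |].
  refine (RInt_gen_norm (gamma_kernel (s + a)) _ _ _ _ _ _ HR).
  - generalize filter_prod_pos_le. apply filter_imp. now intros ab [_ H].
  - generalize filter_prod_pos_le. apply filter_imp. intros [u v] [H0 H1] t Ht; simpl in *.
    unfold norm; simpl; unfold abs; simpl.
    rewrite Rabs_pos_eq by apply Rlt_le, gamma_kernel_pos.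
    unfold gamma_kernel.
    replace (s + a - 1) with ((s - 1) + a) by ring.
    replace (s + 1 - 1) with ((s - 1) + 1) by ring.
    rewrite !Rpower_plus, Rpower_1 by lra.
    assert (Hts : 0 < t / s) by (apply Rdiv_lt_0_compat; lra).
    pose proof (Rpower_le_affine a (t / s) Ha Hts) as HB.
    replace (Rpower t a) with (Rpower s a * Rpower (t / s) a)
      by (rewrite Rpower_mult_distr by lra; f_equal; field; lra).
    assert (0 < Rpower s a) by apply exp_pos.
    assert (0 < Rpower t (s - 1)) by apply exp_pos.
    assert (0 < exp (- t)) by apply exp_pos.
    replace (Rpower s a * ((1 - a) * (Rpower t (s - 1) * exp (- t)) + a / s * (Rpower t (s - 1) * t * exp (- t))))
      with ((Rpower s a * Rpower t (s - 1) * exp (- t)) * (1 - a + a * (t / s))) by (field; lra).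
    replace (Rpower t (s - 1) * (Rpower s a * Rpower (t / s) a) * exp (- t))
      with ((Rpower s a * Rpower t (s - 1) * exp (- t)) * Rpower (t / s) a) by ring.
    apply Rmult_le_compat_l; [| exact HB].
    apply Rlt_le. repeat apply Rmult_lt_0_compat; assumption.
  - apply is_RInt_gen_Gamma; lra.
Qed.

(** Positivity is read off from [Gamma 2 = 1 <= s^(2 - s) Gamma s]. *)
Lemma Gamma_pos_1_2 (s : R) : 1 <= s <= 2 -> 0 < Gamma s.
Proof.
  intros Hs.
  assert (H : Gamma (s + (2 - s)) <= Rpower s (2 - s) * Gamma s) by (apply Gamma_add_le; lra).
  replace (s + (2 - s)) with (1 + 1) in H by ring.
  rewrite Gamma_succ, Gamma_1 in H by lra.
  assert (0 < Rpower s (2 - s)) by apply exp_pos.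
  apply Rnot_le_lt. intros Hn. nra.
Qed.

(** * Sums from 1 *)

Definition sum1 (f : nat -> R) (n : nat) : R := sum_n_m f 1 n.

Lemma sum1_0 (f : nat -> R) : sum1 f 0 = 0.
Proof. apply (sum_n_m_zero f 1 0). lia. Qed.

Lemma sum1_S (f : nat -> R) (n : nat) : sum1 f (S n) = sum1 f n + f (S n).
Proof. apply (sum_n_Sm f 1 n). lia. Qed.

Lemma sum1_ext (f g : nat -> R) (n : nat) :
  (forall k, (1 <= k <= n)%nat -> f k = g k) -> sum1 f n = sum1 g n.
Proof. intros H. now apply (sum_n_m_ext_loc f g 1 n). Qed.

Lemma sum1_plus (f g : nat -> R) (n : nat) :
  sum1 (fun k => f k + g k) n = sum1 f n + sum1 g n.
Proof. apply (sum_n_m_plus f g 1 n). Qed.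

Lemma sum1_scal (c : R) (f : nat -> R) (n : nat) :
  sum1 (fun k => c * f k) n = c * sum1 f n.
Proof. apply (sum_n_m_mult_l c f 1 n). Qed.

Lemma sum1_minus (f g : nat -> R) (n : nat) :
  sum1 (fun k => f k - g k) n = sum1 f n - sum1 g n.
Proof.
  induction n as [|n IH]; [rewrite !sum1_0; ring | rewrite !sum1_S, IH; ring].
Qed.

Lemma sum1_le (f g : nat -> R) (n : nat) :
  (forall k, (1 <= k <= n)%nat -> f k <= g k) -> sum1 f n <= sum1 g n.
Proof.
  induction n as [|n IH]; intros H; [rewrite !sum1_0; lra |].
  rewrite !sum1_S. apply Rplus_le_compat; [apply IH; intros; apply H; lia | apply H; lia].
Qed.

Lemma sum1_swap (f : nat -> nat -> R) (m n : nat) :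
  sum1 (fun i => sum1 (f i) n) m = sum1 (fun j => sum1 (fun i => f i j) m) n.
Proof.
  induction m as [|m IH].
  - rewrite sum1_0. induction n as [|n IH]; [now rewrite sum1_0 |].
    rewrite sum1_S, <- IH, sum1_0; ring.
  - rewrite sum1_S, IH, <- sum1_plus. apply sum1_ext. intros k _. now rewrite sum1_S.
Qed.

Lemma is_series_sum1 (f : nat -> R) (l : R) :
  is_series (fun n => f (S n)) l <-> is_lim_seq (sum1 f) l.
Proof.
  split; intros H.
  - apply is_lim_seq_incr_1.
    apply (is_lim_seq_ext (sum_n (fun n => f (S n)))); [| exact H].
    intros n. apply (sum_n_m_S f 0 n).
  - apply is_lim_seq_incr_1 in H.
    apply (is_lim_seq_ext _ (sum_n (fun n => f (S n)))) in H; [exact H |].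
    intros n. symmetry. apply (sum_n_m_S f 0 n).
Qed.

Lemma is_derive_sum1 (F : nat -> R -> R) (dF : nat -> R) (n : nat) (x : R) :
  (forall k, is_derive (F (S k)) x (dF (S k))) ->
  is_derive (fun y => sum1 (fun k => F k y) n) x (sum1 dF n).
Proof.
  intros H. induction n as [|n IH].
  - apply (is_derive_ext (fun _ => 0)).
    + intros t. now rewrite sum1_0.
    + rewrite sum1_0. auto_derive; easy.
  - apply (is_derive_ext (fun y => sum1 (fun k => F k y) n + F (S n) y)).
    + intros t. now rewrite sum1_S.
    + rewrite sum1_S. now apply (is_derive_plus (fun y => sum1 (fun k => F k y) n)).
Qed.

Lemma sum1_S_l (f : nat -> R) (n : nat) :
  sum1 f (S n) = f 1%nat + sum1 (fun k => f (S k)) n.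
Proof.
  induction n as [|n IH].
  - rewrite sum1_S, !sum1_0. ring.
  - rewrite sum1_S, IH, sum1_S. ring.
Qed.

Lemma sum1_rev (f : nat -> R) (n : nat) : sum1 f n = sum1 (fun k => f (S n - k)%nat) n.
Proof.
  induction n as [|n IH]; [now rewrite !sum1_0 |].
  rewrite sum1_S, IH, sum1_S_l, Rplus_comm.
  replace (S (S n) - 1)%nat with (S n) by lia. reflexivity.
Qed.

Lemma is_RInt_Rplus (f g : R -> R) (a b If Ig : R) :
  is_RInt f a b If -> is_RInt g a b Ig -> is_RInt (fun x => f x + g x) a b (If + Ig).
Proof. apply (is_RInt_plus f g). Qed.

Lemma is_RInt_Rmult (c : R) (f : R -> R) (a b If : R) :
  is_RInt f a b If -> is_RInt (fun x => c * f x) a b (c * If).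
Proof. apply (is_RInt_scal f). Qed.

Lemma is_RInt_zero (a b : R) : is_RInt (fun _ => 0) a b 0.
Proof.
  pose proof (is_RInt_const (V := R_NormedModule) a b 0) as H.
  now rewrite (scal_zero_r (V := R_NormedModule)) in H.
Qed.

Lemma is_RInt_sum1 (F : nat -> R -> R) (I : nat -> R) (a b : R) (n : nat) :
  (forall k, (1 <= k <= n)%nat -> is_RInt (F k) a b (I k)) ->
  is_RInt (fun x => sum1 (fun k => F k x) n) a b (sum1 I n).
Proof.
  induction n as [|n IH]; intros H.
  - apply (is_RInt_ext (fun _ => 0)).
    + intros x _. now rewrite sum1_0.
    + rewrite sum1_0. apply is_RInt_zero.
  - apply (is_RInt_ext (fun x => sum1 (fun k => F k x) n + F (S n) x)).
    + intros x _. now rewrite sum1_S.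
    + rewrite sum1_S.
      apply (is_RInt_plus (fun x => sum1 (fun k => F k x) n) (F (S n))).
      * apply IH. intros k Hk. apply H. lia.
      * apply H. lia.
Qed.

Lemma is_lim_seq_sum1 (f : nat -> nat -> R) (l : nat -> R) (n : nat) :
  (forall k, (1 <= k <= n)%nat -> is_lim_seq (f k) (l k)) ->
  is_lim_seq (fun p => sum1 (fun k => f k p) n) (sum1 l n).
Proof.
  induction n as [|n IH]; intros H.
  - apply (is_lim_seq_ext (fun _ => 0)); [intros p; now rewrite sum1_0 |].
    rewrite sum1_0. apply is_lim_seq_const.
  - apply (is_lim_seq_ext (fun p => sum1 (fun k => f k p) n + f (S n) p)).
    + intros p. now rewrite sum1_S.
    + rewrite sum1_S. apply is_lim_seq_plus'.
      * apply IH. intros k Hk. apply H. lia.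
      * apply H. lia.
Qed.

(** * The digamma function *)

(** Logarithm of the partial Euler product [(n + 1)^x prod_(k <= n) k / (k + x)]. *)
Definition lnGamma_approx (n : nat) (x : R) : R :=
  x * ln (INR n + 1) + sum1 (fun k => ln (INR k) - ln (INR k + x)) n.

Definition shifted_harmonic (n : nat) (x : R) : R := sum1 (fun k => / (INR k + x)) n.

Definition digamma_approx (n : nat) (x : R) : R := ln (INR n + 1) - shifted_harmonic n x.

(** Positivity is carried along because the logarithm of the product needs it. *)
Lemma ln_Gamma_shift (n : nat) (x : R) :
  0 <= x <= 1 ->
  0 < Gamma (INR n + 1 + x) /\
  ln (Gamma (INR n + 1 + x)) = ln (Gamma (1 + x)) + sum1 (fun k => ln (INR k + x)) n.
Proof.
  intros Hx. induction n as [|n [IHp IHe]].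
  - rewrite sum1_0. simpl INR. replace (0 + 1 + x) with (1 + x) by ring.
    split; [apply Gamma_pos_1_2; lra | ring].
  - pose proof (pos_INR n) as Hn.
    rewrite sum1_S, S_INR.
    replace (INR n + 1 + 1 + x) with ((INR n + 1 + x) + 1) by ring.
    rewrite Gamma_succ by lra. split.
    + apply Rmult_lt_0_compat; lra.
    + rewrite ln_mult, IHe by lra. ring.
Qed.

(** [Gamma_add_le] bounds [Gamma (n + 1 + x)] above by [(n + 1)^x Gamma (n + 1)] and
    below by [Gamma (n + 2) / (n + 1 + x)^(1 - x)]; the two bounds differ by the factor
    [((n + 1 + x) / (n + 1))^(1 - x)], whose logarithm is at most [1 / (n + 1)]. *)
Lemma lnGamma_approx_bound (n : nat) (x : R) :
  0 <= x <= 1 -> Rabs (lnGamma_approx n x - ln (Gamma (1 + x))) <= / (INR n + 1).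
Proof.
  intros Hx. pose proof (pos_INR n) as Hn.
  destruct (ln_Gamma_shift n x Hx) as [Hp He].
  assert (H01 : 0 <= 0 <= 1) by lra.
  destruct (ln_Gamma_shift n 0 H01) as [Hp0 He0].
  rewrite Rplus_0_r in Hp0, He0. rewrite Rplus_0_r, Gamma_1, ln_1, Rplus_0_l in He0.
  rewrite (sum1_ext _ (fun k => ln (INR k))) in He0 by (intros; now rewrite Rplus_0_r).
  assert (HU : ln (Gamma (INR n + 1 + x)) <= x * ln (INR n + 1) + ln (Gamma (INR n + 1))).
  { rewrite <- (ln_exp (x * ln (INR n + 1))), <- ln_mult by (try apply exp_pos; assumption).
    apply ln_le; [exact Hp |]. apply (Gamma_add_le (INR n + 1) x); lra. }
  assert (HL : ln (INR n + 1) + ln (Gamma (INR n + 1))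
               <= (1 - x) * ln (INR n + 1 + x) + ln (Gamma (INR n + 1 + x))).
  { rewrite <- (ln_exp ((1 - x) * ln (INR n + 1 + x))), <- !ln_mult by (try apply exp_pos; lra).
    rewrite <- Gamma_succ by lra.
    apply ln_le.
    - rewrite Gamma_succ by lra. apply Rmult_lt_0_compat; lra.
    - replace (INR n + 1 + 1) with (INR n + 1 + x + (1 - x)) by ring.
      apply (Gamma_add_le (INR n + 1 + x) (1 - x)); lra. }
  assert (H1 : 0 <= (1 - x) * (ln (INR n + 1 + x) - ln (INR n + 1)) <= / (INR n + 1)).
  { assert (Ha : ln (INR n + 1) <= ln (INR n + 1 + x)) by (apply ln_le; lra).
    assert (Hb : ln (INR n + 1 + x) <= ln (INR n + 1 + 1)) by (apply ln_le; lra).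
    assert (Hc : ln (INR n + 1 + 1) - ln (INR n + 1) <= / (INR n + 1))
      by (apply ln_succ_sub_bounds; lra).
    nra. }
  unfold lnGamma_approx. rewrite sum1_minus.
  apply Rabs_le. split; lra.
Qed.

Lemma is_derive_lnGamma_approx (n : nat) (x : R) :
  -1 < x -> is_derive (lnGamma_approx n) x (digamma_approx n x).
Proof.
  intros Hx.
  replace (digamma_approx n x) with (ln (INR n + 1) + sum1 (fun k => (-1) * / (INR k + x)) n)
    by (rewrite sum1_scal; unfold digamma_approx, shifted_harmonic; ring).
  apply (is_derive_plus (fun x => x * ln (INR n + 1))
    (fun x => sum1 (fun k => ln (INR k) - ln (INR k + x)) n)).
  - auto_derive; [easy | ring].
  - apply (is_derive_sum1 (fun k x => ln (INR k) - ln (INR k + x))).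
    intros k. pose proof (pos_INR k) as Hk. rewrite S_INR.
    auto_derive; [lra | field; lra].
Qed.

Lemma continuous_shifted_harmonic (n : nat) (x : R) :
  -1 < x -> continuous (shifted_harmonic n) x.
Proof.
  intros Hx. apply (ex_derive_continuous (shifted_harmonic n)).
  exists (sum1 (fun k => - / (INR k + x) ^ 2) n).
  apply (is_derive_sum1 (fun k x => / (INR k + x))).
  intros k. pose proof (pos_INR k) as Hk. rewrite S_INR.
  auto_derive; [lra | field; lra].
Qed.

(** Consecutive approximants differ by [ln (n + 2) - ln (n + 1) - 1 / (n + 1 + x)],
    and both terms lie between [1 / (n + 2)] and [1 / (n + 1)]; these bounds
    telescope. *)
Lemma digamma_approx_cauchy (n p : nat) (x : R) :
  0 <= x <= 1 ->
  Rabs (digamma_approx (n + p) x - digamma_approx n x)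
    <= / (INR n + 1) - / (INR (n + p) + 1).
Proof.
  intros Hx. induction p as [|p IH].
  - rewrite Nat.add_0_r, !Rminus_diag, Rabs_R0. lra.
  - replace (n + S p)%nat with (S (n + p)) by lia.
    set (m := (n + p)%nat) in *. pose proof (pos_INR m) as Hm.
    replace (digamma_approx (S m) x - digamma_approx n x)
      with ((digamma_approx m x - digamma_approx n x)
            + (ln (INR m + 1 + 1) - ln (INR m + 1) - / (INR m + 1 + x)))
      by (unfold digamma_approx, shifted_harmonic; rewrite sum1_S, S_INR; ring).
    rewrite S_INR.
    assert (Hl : / (INR m + 1 + 1) <= ln (INR m + 1 + 1) - ln (INR m + 1) <= / (INR m + 1))
      by (apply ln_succ_sub_bounds; lra).
    assert (/ (INR m + 1 + x) <= / (INR m + 1)) by (apply Rinv_le_contravar; lra).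
    assert (/ (INR m + 1 + 1) <= / (INR m + 1 + x)) by (apply Rinv_le_contravar; lra).
    eapply Rle_trans; [apply Rabs_triang |].
    assert (Rabs (ln (INR m + 1 + 1) - ln (INR m + 1) - / (INR m + 1 + x))
             <= / (INR m + 1) - / (INR m + 1 + 1)) by (apply Rabs_le; lra).
    lra.
Qed.

Lemma is_lim_seq_inv_succ : is_lim_seq (fun n => / (INR n + 1)) 0.
Proof.
  replace (Finite 0) with (Rbar_inv p_infty) by reflexivity.
  apply is_lim_seq_inv; [| easy].
  apply (is_lim_seq_ext (fun n => INR (S n))); [intros; apply S_INR |].
  apply -> is_lim_seq_incr_1. apply is_lim_seq_INR.
Qed.

Lemma eventually_inv_succ_lt (eps : posreal) : eventually (fun n => / (INR n + 1) < eps).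
Proof.
  pose proof is_lim_seq_inv_succ as H. apply is_lim_seq_spec in H.
  destruct (H eps) as [N HN]. exists N. intros n Hn. specialize (HN n Hn).
  rewrite Rminus_0_r in HN. exact (Rle_lt_trans _ _ _ (Rle_abs _) HN).
Qed.

Lemma lnGamma_approx_lim (x : R) :
  0 <= x <= 1 -> is_lim_seq (fun n => lnGamma_approx n x) (ln (Gamma (1 + x))).
Proof.
  intros Hx. apply is_lim_seq_spec. intros eps.
  generalize (eventually_inv_succ_lt eps). apply filter_imp. intros n Hn.
  eapply Rle_lt_trans; [now apply lnGamma_approx_bound | exact Hn].
Qed.

Definition digamma_lim (x : R) : R := Lim_seq (fun n => digamma_approx n x).

Lemma digamma_approx_lim (x : R) :
  0 <= x <= 1 -> is_lim_seq (fun n => digamma_approx n x) (digamma_lim x).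
Proof.
  intros Hx. apply Lim_seq_correct', ex_lim_seq_cauchy_corr. intros eps.
  pose (e2 := pos_div_2 eps).
  destruct (eventually_inv_succ_lt e2) as [N HN]. exists N.
  assert (H : forall m, (N <= m)%nat -> Rabs (digamma_approx m x - digamma_approx N x) < eps / 2).
  { intros m Hm. replace m with (N + (m - N))%nat by lia.
    eapply Rle_lt_trans; [now apply digamma_approx_cauchy |].
    specialize (HN N (Nat.le_refl N)). simpl in HN.
    assert (0 < / (INR (N + (m - N)) + 1)).
    { apply Rinv_0_lt_compat. pose proof (pos_INR (N + (m - N))). lra. }
    lra. }
  intros n m Hn Hm. pose proof (H n Hn) as H1. pose proof (H m Hm) as H2.
  apply Rabs_def2 in H1. apply Rabs_def2 in H2. apply Rabs_def1; lra.
Qed.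

Lemma digamma_approx_bound (n : nat) (x : R) :
  0 <= x <= 1 ->
  Rabs (digamma_approx n x - digamma_lim x) <= / (INR n + 1).
Proof.
  intros Hx. rewrite Rabs_minus_sym.
  change (Rbar_le (Rabs (digamma_lim x - digamma_approx n x)) (/ (INR n + 1))).
  apply (is_lim_seq_le (fun p => Rabs (digamma_approx (p + n) x - digamma_approx n x))
    (fun _ => / (INR n + 1))).
  - intros p. rewrite Nat.add_comm.
    eapply Rle_trans; [now apply digamma_approx_cauchy |].
    assert (0 < / (INR (n + p) + 1)).
    { apply Rinv_0_lt_compat. pose proof (pos_INR (n + p)). lra. }
    lra.
  - apply (is_lim_seq_abs _ (Finite _)).
    apply is_lim_seq_minus'; [| apply is_lim_seq_const].
    apply (is_lim_seq_incr_n (fun n => digamma_approx n x) n). now apply digamma_approx_lim.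
  - apply is_lim_seq_const.
Qed.

(** Both the approximants and their derivatives converge uniformly. *)
Lemma is_derive_ln_Gamma (x : R) :
  0 < x < 1 ->
  is_derive (fun y => ln (Gamma (1 + y))) x (digamma_lim x).
Proof.
  intros Hx.
  set (D := fun y => 0 < y < 1).
  assert (HDe : forall n y, D y -> Derive (lnGamma_approx n) y = digamma_approx n y).
  { intros n y Hy. apply is_derive_unique, is_derive_lnGamma_approx. unfold D in Hy; lra. }
  assert (HDo : open D) by (apply open_and; [apply open_gt | apply open_lt]).
  assert (HLd : forall y, D y ->
            real (Lim_seq (fun n => Derive (lnGamma_approx n) y)) = digamma_lim y)
    by (intros y Hy; unfold digamma_lim; f_equal; apply Lim_seq_ext; intros n; now apply HDe).
  rewrite <- HLd by exact Hx.
  apply (is_derive_ext_loc (fun y => real (Lim_seq (fun n => lnGamma_approx n y)))).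
  - apply (filter_imp D); [| now apply HDo].
    intros y Hy. rewrite (is_lim_seq_unique _ (ln (Gamma (1 + y)))); [reflexivity |].
    apply lnGamma_approx_lim. unfold D in Hy; lra.
  - apply (CVU_Derive lnGamma_approx D); [exact HDo | | | | | | exact Hx].
    + intros a b y Ha Hb Hy. unfold D in *; lra.
    + intros eps. generalize (eventually_inv_succ_lt eps). apply filter_imp. intros n Hn y Hy.
      assert (Hy' : 0 <= y <= 1) by (unfold D in Hy; lra).
      rewrite (is_lim_seq_unique _ _ (lnGamma_approx_lim y Hy')).
      eapply Rle_lt_trans; [now apply lnGamma_approx_bound | exact Hn].
    + intros n y Hy. eexists. apply is_derive_lnGamma_approx. unfold D in Hy; lra.
    + intros n y Hy. apply continuity_pt_filterlim.
      apply (continuous_ext_loc _ (digamma_approx n)).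
      * apply (filter_imp D); [| now apply HDo]. intros z Hz. symmetry; now apply HDe.
      * apply (continuous_minus (fun _ => ln (INR n + 1)) (shifted_harmonic n)).
        -- apply continuous_const.
        -- apply continuous_shifted_harmonic. unfold D in Hy; lra.
    + intros eps. generalize (eventually_inv_succ_lt eps). apply filter_imp. intros n Hn y Hy.
      rewrite HDe, HLd by exact Hy.
      eapply Rle_lt_trans; [apply digamma_approx_bound; unfold D in Hy; lra | exact Hn].
Qed.

Lemma digamma_eq_lim (x : R) :
  0 < x < 1 -> digamma (1 + x) = digamma_lim x.
Proof.
  intros Hx. unfold digamma.
  set (l := digamma_lim x).
  assert (Hp : 0 < Gamma (1 + x)) by (apply Gamma_pos_1_2; lra).
  assert (HG : is_derive Gamma (1 + x) (Gamma (1 + x) * l)).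
  { apply (is_derive_ext_loc (fun z => exp (ln (Gamma (1 + (z - 1)))))).
    - apply (filter_imp (fun z => 1 < z < 2)).
      + intros z Hz. replace (1 + (z - 1)) with z by ring.
        apply exp_ln, Gamma_pos_1_2; lra.
      + apply (open_and (fun z => 1 < z) (fun z => z < 2));
          [apply open_gt | apply open_lt | lra].
    - replace (Gamma (1 + x) * l) with (scal (1 * l) (exp (ln (Gamma (1 + x)))))
        by (rewrite exp_ln by exact Hp; unfold scal; simpl; unfold mult; simpl; ring).
      apply (is_derive_comp exp (fun z => ln (Gamma (1 + (z - 1))))).
      + replace (1 + (1 + x - 1)) with (1 + x) by ring. apply is_derive_exp.
      + apply (is_derive_comp (fun y => ln (Gamma (1 + y))) (fun z => z - 1)).
        * replace (1 + x - 1) with x by ring. now apply is_derive_ln_Gamma.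
        * auto_derive; [easy | ring]. }
  rewrite (is_derive_unique _ _ _ HG). field. lra.
Qed.

(** * The square integral of the approximants *)

(** Proves an identity that [is_RInt_ext] states in the structure-carried type. *)
Ltac Req := match goal with |- @eq _ ?a ?b => change (@eq R a b) end.

Lemma is_RInt_inv_shift (c : R) :
  0 < c -> is_RInt (fun x => / (c + x)) 0 1 (ln (c + 1) - ln c).
Proof.
  intros Hc. replace (ln c) with (ln (c + 0)) by (f_equal; ring).
  apply (is_RInt_derive (fun x => ln (c + x))).
  - intros x Hx. rewrite Rmin_left in Hx by lra. auto_derive; [lra | field; lra].
  - intros x Hx. rewrite Rmin_left in Hx by lra.
    apply (ex_derive_continuous (fun x => / (c + x))). auto_derive. lra.
Qed.

Lemma is_RInt_inv_shift_sq (c : R) :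
  0 < c -> is_RInt (fun x => (/ (c + x)) ^ 2) 0 1 (/ c - / (c + 1)).
Proof.
  intros Hc. replace (/ c - / (c + 1)) with (minus (- / (c + 1)) (- / (c + 0)))
    by (unfold minus, plus, opp; simpl; field; lra).
  apply (is_RInt_derive (fun x => - / (c + x))).
  - intros x Hx. rewrite Rmin_left in Hx by lra. auto_derive; [lra | field; lra].
  - intros x Hx. rewrite Rmin_left in Hx by lra.
    apply (ex_derive_continuous (fun x => (/ (c + x)) ^ 2)). auto_derive. lra.
Qed.

Lemma is_RInt_shifted_harmonic (n : nat) : is_RInt (shifted_harmonic n) 0 1 (ln (INR n + 1)).
Proof.
  replace (ln (INR n + 1)) with (sum1 (fun k => ln (INR k + 1) - ln (INR k)) n).
  - apply (is_RInt_sum1 (fun k x => / (INR k + x))).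
    intros k Hk. apply is_RInt_inv_shift. apply lt_0_INR. lia.
  - induction n as [|n IH].
    + rewrite sum1_0. simpl. rewrite Rplus_0_l, ln_1. reflexivity.
    + rewrite sum1_S, IH, S_INR. ring.
Qed.

(** Partial fractions, with the sum reversed so that the denominators that come out
    are 1, ..., n. *)
Lemma shifted_harmonic_mul_inv (n : nat) (x : R) :
  0 <= x ->
  shifted_harmonic n x * / (INR n + 1 + x) =
  sum1 (fun m => / INR m * (/ (INR (S n - m) + x) - / (INR n + 1 + x))) n.
Proof.
  intros Hx. unfold shifted_harmonic. rewrite sum1_rev, Rmult_comm, <- sum1_scal.
  apply sum1_ext. intros m Hm.
  assert (0 < INR m) by (apply lt_0_INR; lia).
  assert (0 < INR (S n - m)) by (apply lt_0_INR; lia).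
  assert (He : INR n + 1 = INR (S n - m) + INR m) by (rewrite minus_INR, S_INR by lia; ring).
  rewrite He. field. lra.
Qed.

(** Induction on [n]: the new cross terms split into partial fractions, and the
    logarithms that they integrate to, together with the new diagonal term, are exactly
    the increment of the right-hand side. *)
Lemma is_RInt_shifted_harmonic_sq (n : nat) :
  is_RInt (fun x => shifted_harmonic n x ^ 2) 0 1
    (1 - / (INR n + 1)
     + 2 * sum1 (fun m => ln (INR (S n - m)) / INR m) n
     - 2 * ln (INR n + 1) * sum1 (fun m => / INR m) n
     + 2 * sum1 (fun k => ln (INR k + 1) / INR k) n).
Proof.
  induction n as [|n IH].
  - rewrite !sum1_0. simpl INR.
    replace (1 - / (0 + 1) + 2 * 0 - 2 * ln (0 + 1) * 0 + 2 * 0) with 0 by field.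
    apply (is_RInt_ext (fun _ => 0)).
    + intros x _. unfold shifted_harmonic. rewrite sum1_0.  Req. ring.
    + apply is_RInt_zero.
  - pose proof (pos_INR n) as Hn.
    assert (HC : is_RInt (fun x => shifted_harmonic n x * / (INR n + 1 + x)) 0 1
       (sum1 (fun m => / INR m * ((ln (INR (S n - m) + 1) - ln (INR (S n - m)))
                                  - (ln (INR n + 1 + 1) - ln (INR n + 1)))) n)).
    { apply (is_RInt_ext (fun x =>
        sum1 (fun m => / INR m * (/ (INR (S n - m) + x) - / (INR n + 1 + x))) n)).
      - intros x Hx. rewrite Rmin_left in Hx by lra. symmetry.
        apply shifted_harmonic_mul_inv. lra.
      - apply (is_RInt_sum1 (fun m x => / INR m * (/ (INR (S n - m) + x) - / (INR n + 1 + x)))).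
        intros m Hm.
        apply (is_RInt_scal (fun x => / (INR (S n - m) + x) - / (INR n + 1 + x))).
        apply (is_RInt_minus (fun x => / (INR (S n - m) + x)) (fun x => / (INR n + 1 + x)));
          apply is_RInt_inv_shift; [apply lt_0_INR; lia | lra]. }
    assert (HS := is_RInt_inv_shift_sq (INR n + 1) ltac:(lra)).
    pose proof (is_RInt_Rplus _ _ _ _ _ _ IH
      (is_RInt_Rplus _ _ _ _ _ _ (is_RInt_Rmult 2 _ _ _ _ HC) HS)) as H.
    match type of H with is_RInt _ _ _ ?v => match goal with |- is_RInt _ _ _ ?w =>
      replace w with v end end.
    + revert H. apply is_RInt_ext. intros x _. Req.
      unfold shifted_harmonic. rewrite sum1_S, S_INR. ring.
    + rewrite (sum1_ext (fun m => / INR m * _) (fun m =>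
         (ln (INR (S (S n) - m)) / INR m - ln (INR (S n - m)) / INR m)
         - (ln (INR n + 1 + 1) - ln (INR n + 1)) * / INR m)).
      * rewrite !sum1_minus, sum1_scal, !sum1_S.
        replace (S (S n) - S n)%nat with 1%nat by lia.
        rewrite INR_1, ln_1, !S_INR. field. lra.
      * intros m Hm. assert (0 < INR m) by (apply lt_0_INR; lia).
        replace (S (S n) - m)%nat with (S (S n - m)) by lia.
        rewrite S_INR. field. lra.
Qed.

(** The [H_n ln (n + 1)] of [is_RInt_shifted_harmonic_sq] is absorbed in the first
    logarithmic sum, and [1 / k = 1 / (k (k + 1)) + 1 / (k + 1)] splits the second. *)
Lemma is_RInt_digamma_approx_sq (n : nat) :
  is_RInt (fun x => digamma_approx n x ^ 2) 0 1
    (1 - / (INR n + 1)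
     - 2 * sum1 (fun m => - ln (1 - INR m / (INR n + 1)) / INR m) n
     + 2 * sum1 (fun k => ln (INR k + 1) / (INR k * (INR k + 1))) n
     + 2 * (sum1 (fun k => ln (INR k) / INR k) (S n) - / 2 * ln (INR (S n)) ^ 2)).
Proof.
  pose proof (pos_INR n) as Hn.
  assert (HC : is_RInt (fun _ => ln (INR n + 1) ^ 2) 0 1 (ln (INR n + 1) ^ 2)).
  { pose proof (is_RInt_const (V := R_NormedModule) 0 1 (ln (INR n + 1) ^ 2)) as H.
    rewrite Rminus_0_r in H. now rewrite (scal_one (V := R_NormedModule)) in H. }
  pose proof (is_RInt_Rplus _ _ _ _ _ _
    (is_RInt_Rplus _ _ _ _ _ _ HC
      (is_RInt_Rmult (-2 * ln (INR n + 1)) _ _ _ _ (is_RInt_shifted_harmonic n)))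
    (is_RInt_shifted_harmonic_sq n)) as H.
  match type of H with is_RInt _ _ _ ?v => match goal with |- is_RInt _ _ _ ?w =>
      replace w with v end end.
  - revert H. apply is_RInt_ext. intros x _. Req.
    unfold digamma_approx. ring.
  - rewrite (sum1_ext (fun m => - ln (1 - INR m / (INR n + 1)) / INR m)
      (fun m => ln (INR n + 1) * / INR m - ln (INR (S n - m)) / INR m)).
    + rewrite (sum1_ext (fun k => ln (INR k + 1) / INR k)
        (fun k => ln (INR k + 1) / (INR k * (INR k + 1)) + ln (INR (S k)) / INR (S k))).
      * rewrite sum1_plus, sum1_minus, sum1_scal, (sum1_S_l _ n).
        rewrite INR_1, ln_1, S_INR. field. lra.
      * intros k Hk. assert (0 < INR k) by (apply lt_0_INR; lia).
        rewrite S_INR. field. lra.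
    + intros m Hm. assert (0 < INR m) by (apply lt_0_INR; lia).
      assert (0 < INR (S n - m)) by (apply lt_0_INR; lia).
      assert (He : INR n + 1 = INR (S n - m) + INR m) by (rewrite minus_INR, S_INR by lia; ring).
      replace (1 - INR m / (INR n + 1)) with (INR (S n - m) / (INR n + 1))
        by (rewrite He; field; lra).
      rewrite ln_div by lra. field. lra.
Qed.

(** * A Riemann sum for the dilogarithm at 1 *)

Lemma ex_series_le_telescoping (a b : nat -> R) :
  (forall n, 0 <= a n <= b n - b (S n)) -> (forall n, 0 <= b n) -> ex_series a.
Proof.
  intros Ha Hb.
  assert (HS : forall n, sum_n a n <= b 0%nat - b (S n)).
  { induction n as [|n IH].
    - rewrite sum_O. apply Ha.
    - rewrite sum_Sn. unfold plus; simpl. specialize (Ha (S n)). lra. }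
  destruct (ex_finite_lim_seq_incr (sum_n a) (b 0%nat)) as [l Hl].
  - intros n. rewrite sum_Sn. unfold plus; simpl. specialize (Ha (S n)). lra.
  - intros n. specialize (HS n). specialize (Hb (S n)). lra.
  - now exists l.
Qed.

Lemma sum1_inv_sq_lim : is_lim_seq (sum1 (fun k => / INR k ^ 2)) (zeta 2).
Proof.
  apply is_series_sum1.
  assert (HE : forall n, / Rpower (INR (S n)) 2 = / INR (S n) ^ 2).
  { intros n. f_equal. replace 2 with (INR 2) by (simpl; ring).
    rewrite Rpower_pow; [reflexivity | apply lt_0_INR; lia]. }
  apply (is_series_ext (fun n => / Rpower (INR (S n)) 2)); [exact HE |].
  apply Series_correct.
  apply (ex_series_ext (fun n => / INR (S n) ^ 2)); [now symmetry |].
  apply ex_series_le_telescoping with (b := fun n => 2 / INR (S n)).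
  - intros n. pose proof (pos_INR n) as Hn. rewrite !S_INR. set (x := INR n) in *.
    split; [apply Rlt_le, Rinv_0_lt_compat, pow_lt; lra |].
    replace (2 / (x + 1) - 2 / (x + 1 + 1)) with (/ ((x + 1) * ((x + 2) / 2))) by (field; lra).
    apply Rinv_le_contravar; [apply Rmult_lt_0_compat; lra | simpl; nra].
  - intros n. apply Rlt_le, Rdiv_lt_0_compat; [lra | apply lt_0_INR; lia].
Qed.

Lemma sum1_inv_sq_le_zeta2 (n : nat) : sum1 (fun k => / INR k ^ 2) n <= zeta 2.
Proof.
  apply (is_lim_seq_incr_compare (sum1 (fun k => / INR k ^ 2))).
  - apply sum1_inv_sq_lim.
  - intros k. rewrite sum1_S.
    assert (0 < / INR (S k) ^ 2) by (apply Rinv_0_lt_compat, pow_lt, lt_0_INR; lia).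
    lra.
Qed.

Lemma sum1_geom (t : R) (J : nat) :
  t < 1 -> sum1 (fun j => t ^ pred j) J = / (1 - t) - t ^ J / (1 - t).
Proof.
  intros Ht. induction J as [|J IH].
  - rewrite sum1_0. simpl. field. lra.
  - rewrite sum1_S, IH. simpl. field. lra.
Qed.

(** The remainder has derivative [t^J / (1 - t)]. *)
Lemma neg_ln_taylor_bounds (u : R) (J : nat) :
  0 <= u < 1 ->
  0 <= - ln (1 - u) - sum1 (fun j => u ^ j / INR j) J <= u ^ J * (u / (1 - u)).
Proof.
  intros Hu.
  set (phi := fun t => - ln (1 - t) - sum1 (fun j => t ^ j / INR j) J).
  assert (Hd : forall t, 0 <= t <= u -> is_derive phi t (t ^ J / (1 - t))).
  { intros t Ht.
    replace (t ^ J / (1 - t)) with (/ (1 - t) - sum1 (fun j => t ^ pred j) J)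
      by (rewrite sum1_geom by lra; ring).
    apply (is_derive_minus (fun t => - ln (1 - t)) (fun t => sum1 (fun j => t ^ j / INR j) J)).
    - auto_derive; [lra | field; lra].
    - apply (is_derive_sum1 (fun j t => t ^ j / INR j) (fun j => t ^ pred j)).
      intros j. assert (0 < INR (S j)) by (apply lt_0_INR; lia).
      set (c := INR (S j)) in *. auto_derive; [easy |].
      change (1 * (c * t ^ j) * / c = t ^ j). field. lra. }
  destruct (MVT_gen phi 0 u (fun t => t ^ J / (1 - t))) as (c & Hc & He).
  - intros t Ht. rewrite Rmin_left, Rmax_right in Ht by lra. apply Hd; lra.
  - intros t Ht. rewrite Rmin_left, Rmax_right in Ht by lra.
    apply continuity_pt_filterlim, (ex_derive_continuous phi).
    eexists. now apply Hd.
  - rewrite Rmin_left, Rmax_right in Hc by lra.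
    assert (H0 : phi 0 = 0).
    { unfold phi. rewrite Rminus_0_r, ln_1.
      rewrite (sum1_ext _ (fun j => 0 * / INR j)).
      - rewrite sum1_scal. ring.
      - intros j Hj. rewrite pow_i by lia. unfold Rdiv. ring. }
    fold (phi u). rewrite H0, !Rminus_0_r in He. rewrite He.
    assert (Hc1 : 0 <= c ^ J <= u ^ J) by (split; [apply pow_le | apply pow_incr]; lra).
    assert (Hc2 : 0 < / (1 - c) <= / (1 - u))
      by (split; [apply Rinv_0_lt_compat | apply Rinv_le_contravar]; lra).
    unfold Rdiv. split.
    + apply Rmult_le_pos; [apply Rmult_le_pos |]; lra.
    + replace (u ^ J * (u * / (1 - u))) with (u ^ J * / (1 - u) * u) by ring.
      apply Rmult_le_compat_r; [lra |]. apply Rmult_le_compat; lra.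
Qed.

Lemma neg_ln_taylor_lim (u : R) :
  0 <= u < 1 -> is_lim_seq (sum1 (fun j => u ^ j / INR j)) (- ln (1 - u)).
Proof.
  intros Hu.
  apply (is_lim_seq_le_le (fun J => - ln (1 - u) - u ^ J * (u / (1 - u))) _ (fun _ => - ln (1 - u))).
  - intros J. pose proof (neg_ln_taylor_bounds u J Hu). lra.
  - assert (H : is_lim_seq (fun J => - ln (1 - u) - u ^ J * (u / (1 - u)))
                  (- ln (1 - u) - 0 * (u / (1 - u)))).
    { apply is_lim_seq_minus'; [apply is_lim_seq_const |].
      apply is_lim_seq_mult'; [| apply is_lim_seq_const].
      apply is_lim_seq_geom. rewrite Rabs_pos_eq; lra. }
    rewrite Rmult_0_l, Rminus_0_r in H. exact H.
  - apply is_lim_seq_const.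
Qed.

Lemma pow_succ_sub_bounds (x : R) (i : nat) :
  0 <= x -> INR (S i) * x ^ i <= (x + 1) ^ S i - x ^ S i <= INR (S i) * (x + 1) ^ i.
Proof.
  intros Hx. induction i as [|i IH].
  - simpl. lra.
  - rewrite (S_INR (S i)).
    assert (E1 : (x + 1) ^ S (S i) - x ^ S (S i) = (x + 1) * ((x + 1) ^ S i - x ^ S i) + x ^ S i)
      by (simpl; ring).
    assert (E2 : (x + 1) ^ S (S i) - x ^ S (S i) = x * ((x + 1) ^ S i - x ^ S i) + (x + 1) ^ S i)
      by (simpl; ring).
    assert (Hm : x ^ S i <= (x + 1) ^ S i) by (apply pow_incr; lra).
    destruct IH as [IH1 IH2]. split.
    + rewrite E2. apply (Rmult_le_compat_l x) in IH1; [| lra].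
      change (x ^ S i) with (x * x ^ i) in *. lra.
    + rewrite E1. apply (Rmult_le_compat_l (x + 1)) in IH2; [| lra].
      change ((x + 1) ^ S i) with ((x + 1) * (x + 1) ^ i) in *. lra.
Qed.

(** The differences [(x + 1)^(i + 1) - x^(i + 1)] telescope. *)
Lemma sum1_pow_bounds (n i : nat) :
  let T := sum1 (fun m => INR m ^ i) n in
  INR (S i) * T <= (INR n + 1) ^ S i <= INR (S i) * (T + (INR n + 1) ^ i).
Proof.
  intros T; unfold T; clear T. induction n as [|n IH].
  - rewrite sum1_0. change (INR 0) with 0. rewrite !Rplus_0_l, !pow1, S_INR.
    pose proof (pos_INR i). lra.
  - rewrite sum1_S. rewrite (S_INR n).
    pose proof (pos_INR n) as Hn.
    pose proof (pow_succ_sub_bounds (INR n + 1) i ltac:(lra)). lra.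
Qed.

(** Riemann sum of [-ln(1 - u) / u] on the unit interval *)
Definition dilog_riemann_sum (n : nat) : R :=
  sum1 (fun m => - ln (1 - INR m / (INR n + 1)) / INR m) n.

(** Contribution of the term [u^j / j] of [- ln (1 - u)] to [dilog_riemann_sum n]. *)
Definition dilog_riemann_term (n j : nat) : R :=
  sum1 (fun m => (INR m / (INR n + 1)) ^ j / INR j / INR m) n.

(** The term is [1 / j] times a Riemann sum of [u^(j - 1)], whose integral is
    [1 / j]. *)
Lemma dilog_riemann_term_bounds (n j : nat) :
  (1 <= j)%nat ->
  / INR j ^ 2 - / (INR n + 1) * / INR j <= dilog_riemann_term n j <= / INR j ^ 2.
Proof.
  intros Hj. destruct j as [|i]; [lia |].
  pose proof (pos_INR n) as Hn. set (N := INR n + 1).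
  assert (HN : 0 < N) by (unfold N; lra).
  assert (Hi : 0 < INR (S i)) by (apply lt_0_INR; lia).
  assert (HP : 0 < N ^ S i) by now apply pow_lt.
  assert (HE : dilog_riemann_term n (S i)
            = / (INR (S i) * N ^ S i) * sum1 (fun m => INR m ^ i) n).
  { unfold dilog_riemann_term. rewrite <- sum1_scal. apply sum1_ext. intros m Hm.
    assert (0 < INR m) by (apply lt_0_INR; lia).
    fold N. unfold Rdiv. rewrite Rpow_mult_distr, pow_inv.
    change (INR m ^ S i) with (INR m * INR m ^ i). field. lra. }
  destruct (sum1_pow_bounds n i) as [H1 H2]. fold N in H1, H2.
  rewrite HE. set (T := sum1 (fun m => INR m ^ i) n) in *.
  set (c := INR (S i)) in *. set (Q := N ^ S i) in *.
  assert (Hc : 0 < / (c ^ 2 * Q)).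
  { apply Rinv_0_lt_compat, Rmult_lt_0_compat; [apply pow_lt |]; assumption. }
  split.
  - assert (HQ : Q = N * N ^ i) by reflexivity.
    assert (0 < N ^ i) by now apply pow_lt.
    apply (Rmult_le_compat_l (/ (c ^ 2 * Q))) in H2; [| lra].
    replace (/ (c ^ 2 * Q) * Q) with (/ c ^ 2) in H2 by (field; lra).
    replace (/ (c ^ 2 * Q) * (c * (T + N ^ i)))
      with (/ (c * Q) * T + / N * / c) in H2 by (rewrite HQ; field; lra).
    lra.
  - apply (Rmult_le_compat_l (/ (c ^ 2 * Q))) in H1; [| lra].
    replace (/ (c ^ 2 * Q) * Q) with (/ c ^ 2) in H1 by (field; lra).
    replace (/ (c ^ 2 * Q) * (c * T)) with (/ (c * Q) * T) in H1 by (field; lra).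
    lra.
Qed.

Lemma sum1_dilog_riemann_term (n J : nat) :
  sum1 (dilog_riemann_term n) J
  = sum1 (fun m => sum1 (fun j => (INR m / (INR n + 1)) ^ j / INR j) J / INR m) n.
Proof.
  unfold dilog_riemann_term.
  rewrite (sum1_swap (fun j m => (INR m / (INR n + 1)) ^ j / INR j / INR m)).
  apply sum1_ext. intros m _.
  transitivity (sum1 (fun j => / INR m * ((INR m / (INR n + 1)) ^ j / INR j)) J).
  - apply sum1_ext. intros j _. apply Rmult_comm.
  - rewrite sum1_scal. apply Rmult_comm.
Qed.

Lemma ratio_lt_1 (n m : nat) : (m <= n)%nat -> 0 <= INR m / (INR n + 1) < 1.
Proof.
  intros Hm. apply le_INR in Hm. pose proof (pos_INR m) as Hm0.
  split.
  - apply Rmult_le_pos; [lra | apply Rlt_le, Rinv_0_lt_compat; lra].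
  - apply Rmult_lt_reg_r with (INR n + 1); [lra |]. unfold Rdiv.
    rewrite Rmult_assoc, Rinv_l by lra. lra.
Qed.

(** With [n] fixed, the truncations of the logarithmic series after [J] terms increase to
    the sum, and each is at most the sum of [1 / j ^ 2] over [j <= J]. *)
Lemma dilog_riemann_sum_le (n : nat) : dilog_riemann_sum n <= zeta 2.
Proof.
  assert (HL : is_lim_seq (sum1 (dilog_riemann_term n)) (dilog_riemann_sum n)).
  { eapply is_lim_seq_ext; [intros J; symmetry; apply sum1_dilog_riemann_term |].
    apply (is_lim_seq_sum1
      (fun m J => sum1 (fun j => (INR m / (INR n + 1)) ^ j / INR j) J / INR m)
      (fun m => - ln (1 - INR m / (INR n + 1)) / INR m)).
    intros m Hm. apply is_lim_seq_mult'; [| apply is_lim_seq_const].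
    apply neg_ln_taylor_lim, ratio_lt_1. lia. }
  change (Rbar_le (dilog_riemann_sum n) (zeta 2)).
  apply (is_lim_seq_le (sum1 (dilog_riemann_term n)) (fun _ => zeta 2));
    [| exact HL | apply is_lim_seq_const].
  intros J. eapply Rle_trans; [| apply (sum1_inv_sq_le_zeta2 J)].
  apply sum1_le. intros j Hj. apply dilog_riemann_term_bounds. lia.
Qed.

(** Truncating the logarithmic series after [n] terms keeps the total error, a
    harmonic number over [n + 1], negligible. *)
Lemma dilog_riemann_sum_ge (n : nat) :
  sum1 (fun k => / INR k ^ 2) n - / (INR n + 1) * sum1 (fun k => / INR k) n
  <= dilog_riemann_sum n.
Proof.
  apply Rle_trans with (sum1 (dilog_riemann_term n) n).
  - rewrite <- sum1_scal, <- sum1_minus. apply sum1_le.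
    intros j Hj. apply dilog_riemann_term_bounds. lia.
  - rewrite sum1_dilog_riemann_term. apply sum1_le. intros m Hm.
    apply Rmult_le_compat_r.
    + apply Rlt_le, Rinv_0_lt_compat, lt_0_INR. lia.
    + pose proof (neg_ln_taylor_bounds _ n (ratio_lt_1 n m ltac:(lia))). lra.
Qed.

(** [D_0] is zero and the [D_n] stay within 1 of it, so at [x = 0] the harmonic number
    is at most [1 + ln (n + 1)]. *)
Lemma harmonic_over_succ_lim : is_lim_seq (fun n => / (INR n + 1) * sum1 (fun k => / INR k) n) 0.
Proof.
  apply (is_lim_seq_le_le (fun _ => 0) _
    (fun n => / (INR n + 1) + ln (INR (S n)) / INR (S n))).
  - intros n. pose proof (pos_INR n) as Hn.
    assert (Hi : 0 < / (INR n + 1)) by (apply Rinv_0_lt_compat; lra).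
    assert (H0 : 0 <= sum1 (fun k => / INR k) n).
    { replace 0 with (sum1 (fun k => 0 * / INR k) n) by (rewrite sum1_scal; ring).
      apply sum1_le. intros k Hk. rewrite Rmult_0_l.
      apply Rlt_le, Rinv_0_lt_compat, lt_0_INR. lia. }
    assert (H1 : sum1 (fun k => / INR k) n <= 1 + ln (INR n + 1)).
    { pose proof (digamma_approx_cauchy 0 n 0 ltac:(lra)) as H.
      unfold digamma_approx, shifted_harmonic in H. rewrite sum1_0 in H. simpl in H.
      rewrite Rplus_0_l, ln_1, Rinv_1 in H.
      rewrite (sum1_ext _ (fun k => / INR k)) in H by (intros; now rewrite Rplus_0_r).
      apply Rabs_le_between in H. lra. }
    split; [apply Rmult_le_pos; lra |].
    rewrite S_INR. unfold Rdiv.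
    apply (Rmult_le_compat_l (/ (INR n + 1))) in H1; [| lra]. lra.
  - apply is_lim_seq_const.
  - replace (Finite 0) with (Finite (0 + 0)) by (f_equal; ring).
    apply is_lim_seq_plus'; [apply is_lim_seq_inv_succ |].
    apply (is_lim_seq_incr_1 (fun n => ln (INR n) / INR n)).
    apply (is_lim_comp_seq (fun y => ln y / y) INR p_infty 0).
    + apply is_lim_div_ln_p.
    + now exists 0%nat.
    + apply is_lim_seq_INR.
Qed.

Lemma dilog_riemann_sum_lim : is_lim_seq dilog_riemann_sum (zeta 2).
Proof.
  apply (is_lim_seq_le_le
    (fun n => sum1 (fun k => / INR k ^ 2) n - / (INR n + 1) * sum1 (fun k => / INR k) n)
    _ (fun _ => zeta 2)).
  - intros n. split; [apply dilog_riemann_sum_ge | apply dilog_riemann_sum_le].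
  - replace (zeta 2) with (zeta 2 - 0) by ring.
    apply is_lim_seq_minus'; [apply sum1_inv_sq_lim | apply harmonic_over_succ_lim].
  - apply is_lim_seq_const.
Qed.

(** * Passage to the limit *)

(** The majorant telescopes: with [b_n = (2 + ln n) / n], the difference
    [b_n - b_(n + 1)] dominates because [(n + 1) (ln (n + 1) - ln n) <= 2]. *)
Lemma ex_series_ln_over_pronic :
  ex_series (fun n : nat => ln (INR (S n) + 1) / (INR (S n) * (INR (S n) + 1))).
Proof.
  apply ex_series_le_telescoping with (b := fun n => (2 + ln (INR (S n))) / INR (S n)).
  - intros n. rewrite !S_INR. set (x := INR n + 1).
    assert (Hx : 1 <= x) by (unfold x; pose proof (pos_INR n); lra).
    assert (Hp : 0 < / (x * (x + 1))) by (apply Rinv_0_lt_compat, Rmult_lt_0_compat; lra).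
    assert (Hl : 0 <= ln (x + 1)) by (rewrite <- ln_1; apply ln_le; lra).
    split; [apply Rmult_le_pos; lra |].
    pose proof (proj2 (ln_succ_sub_bounds x ltac:(lra))) as H1.
    assert (H2 : (x + 1) * (ln (x + 1) - ln x) <= 2).
    { apply Rle_trans with ((x + 1) * / x); [apply Rmult_le_compat_l; lra |].
      replace ((x + 1) * / x) with (1 + / x) by (field; lra).
      assert (/ x <= / 1) by (apply Rinv_le_contravar; lra). lra. }
    replace ((2 + ln x) / x - (2 + ln (x + 1)) / (x + 1))
      with ((2 + ln (x + 1) - (x + 1) * (ln (x + 1) - ln x)) * / (x * (x + 1)))
      by (field; lra).
    unfold Rdiv. apply Rmult_le_compat_r; lra.
  - intros n. assert (1 <= INR (S n)) by (rewrite S_INR; pose proof (pos_INR n); lra).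
    assert (0 <= ln (INR (S n))) by (rewrite <- ln_1; apply ln_le; lra).
    apply Rmult_le_pos; [lra | apply Rlt_le, Rinv_0_lt_compat; lra].
Qed.

Lemma Rabs_sq_sub_le (a b e : R) :
  Rabs a <= 1 -> Rabs b <= 1 -> Rabs (a - b) <= e -> Rabs (a ^ 2 - b ^ 2) <= 2 * e.
Proof.
  intros Ha Hb He. replace (a ^ 2 - b ^ 2) with ((a - b) * (a + b)) by ring.
  rewrite Rabs_mult.
  assert (Rabs (a + b) <= 2) by (eapply Rle_trans; [apply Rabs_triang | lra]).
  pose proof (Rabs_pos (a - b)). pose proof (Rabs_pos (a + b)). nra.
Qed.

(** The approximants converge uniformly on the unit interval and are bounded by 1
    there, so their squares converge uniformly as well. *)
Lemma is_RInt_digamma_sq_of_approx :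
  exists l : R,
    is_lim_seq (fun n => RInt (fun x => digamma_approx n x ^ 2) 0 1) l /\
    is_RInt (fun x => digamma (1 + x) ^ 2) 0 1 l.
Proof.
  (* Uniform convergence is over the whole line, so the argument is clamped. *)
  set (clamp := fun x => Rmax 0 (Rmin x 1)).
  assert (Hcl : forall x, 0 <= clamp x <= 1).
  { intros x. split; [apply Rmax_l | apply Rmax_lub; [lra | apply Rmin_r]]. }
  assert (Hid : forall x, 0 < x < 1 -> clamp x = x).
  { intros x Hx. unfold clamp. rewrite Rmin_left, Rmax_right; lra. }
  destruct (filterlim_RInt (V := R_CompleteNormedModule)
    (fun n x => digamma_approx n (clamp x) ^ 2) 0 1 eventually _
    (fun x => digamma_lim (clamp x) ^ 2)
    (fun n => RInt (fun x => digamma_approx n x ^ 2) 0 1)) as (l & Hl & HI).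
  - intros n. apply (is_RInt_ext (fun x => digamma_approx n x ^ 2)).
    + intros x Hx. rewrite Rmin_left, Rmax_right in Hx by lra. now rewrite Hid.
    + apply (RInt_correct (V := R_CompleteNormedModule)).
      eexists. apply is_RInt_digamma_approx_sq.
  - apply filterlim_locally. intros eps.
    generalize (eventually_inv_succ_lt (pos_div_2 eps)). apply filter_imp. intros n Hn x.
    apply <- ball_Rabs. simpl in Hn.
    assert (H1 : Rabs (digamma_approx n (clamp x)) <= 1).
    { pose proof (digamma_approx_cauchy 0 n (clamp x) (Hcl x)) as H.
      unfold digamma_approx at 2, shifted_harmonic in H. rewrite sum1_0 in H. simpl in H.
      rewrite Rplus_0_l, ln_1, Rinv_1, !Rminus_0_r in H.
      assert (0 < / (INR n + 1)) by (apply Rinv_0_lt_compat; pose proof (pos_INR n); lra).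
      lra. }
    assert (H2 : Rabs (digamma_lim (clamp x)) <= 1).
    { pose proof (digamma_approx_bound 0 (clamp x) (Hcl x)) as H.
      unfold digamma_approx, shifted_harmonic in H. rewrite sum1_0 in H. simpl in H.
      rewrite Rplus_0_l, ln_1, Rinv_1 in H.
      apply Rabs_le_between in H. apply Rabs_le. lra. }
    eapply Rle_lt_trans.
    + apply Rabs_sq_sub_le; [exact H1 | exact H2 |].
      apply digamma_approx_bound, Hcl.
    + lra.
  - exists l. split; [exact Hl |].
    revert HI. apply is_RInt_ext. intros x Hx. rewrite Rmin_left, Rmax_right in Hx by lra.
    now rewrite Hid, digamma_eq_lim.
Qed.

Theorem mainTheorem1 :
  ex_series (fun n : nat => ln (INR (S n) + 1) / (INR (S n) * (INR (S n) + 1))) /\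
  is_RInt (fun x : R => (digamma (1 + x)) ^ 2) 0 1
    (2 * Series (fun n : nat => ln (INR (S n) + 1) / (INR (S n) * (INR (S n) + 1)))
     + 1 - 2 * zeta 2 + 2 * stieltjes1).
Proof.
  split; [exact ex_series_ln_over_pronic |].
  destruct is_RInt_digamma_sq_of_approx as (l & Hl & HI).
  set (A := Series _).
  assert (HA : is_lim_seq (sum1 (fun k => ln (INR k + 1) / (INR k * (INR k + 1)))) A)
    by (apply is_series_sum1, Series_correct, ex_series_ln_over_pronic).
  (* Solving the exact formula for the Stieltjes sequence shows that it converges. *)
  assert (Hg : is_lim_seq
    (fun N => sum_n_m (fun k => ln (INR k) / INR k) 1 N - / 2 * ln (INR N) ^ 2)
    (/ 2 * (l - 1 + 2 * zeta 2 - 2 * A))).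
  { apply is_lim_seq_incr_1.
    apply (is_lim_seq_ext (fun n => / 2 *
      (RInt (fun x => digamma_approx n x ^ 2) 0 1 - (1 - / (INR n + 1))
       + 2 * dilog_riemann_sum n
       - 2 * sum1 (fun k => ln (INR k + 1) / (INR k * (INR k + 1))) n))).
    - intros n. rewrite (is_RInt_unique _ _ _ _ (is_RInt_digamma_approx_sq n)).
      unfold dilog_riemann_sum. fold (sum1 (fun k => ln (INR k) / INR k) (S n)). field.
      pose proof (pos_INR n). lra.
    - apply is_lim_seq_mult'; [apply is_lim_seq_const |].
      apply is_lim_seq_minus';
        [| apply is_lim_seq_mult'; [apply is_lim_seq_const | exact HA]].
      apply is_lim_seq_plus';
        [| apply is_lim_seq_mult'; [apply is_lim_seq_const | exact dilog_riemann_sum_lim]].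
      apply is_lim_seq_minus'; [exact Hl |].
      replace (Finite 1) with (Finite (1 - 0)) by (f_equal; ring).
      apply is_lim_seq_minus'; [apply is_lim_seq_const | exact is_lim_seq_inv_succ]. }
  replace (2 * A + 1 - 2 * zeta 2 + 2 * stieltjes1) with l; [exact HI |].
  unfold stieltjes1. rewrite (is_lim_seq_unique _ _ Hg). simpl. field.
Qed.
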